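(* Let $\Bbbk$ be a field of characteristic zero and let $n\ge 1$ be an integer. Then the artinian algebra $A(T_{5,n})$ has the weak Lefschetz property if and only if $n\in\{1,2,3,5,6,9\}$.
   Context: For integers $m\ge 3$, $n\ge 1$, the tadpole graph $T_{m,n}$ is the simple graph with vertex set $\{x_1,\dots,x_m,y_1,\dots,y_n\}$ and edges $\{x_i,x_{i+1}\}$ for $1\le i\le m-1$, $\{x_m,x_1\}$ (so the $x_i$ form an $m$-cycle), $\{y_j,y_{j+1}\}$ for $1\le j\le n-1$ (so the $y_j$ form a path), and the bridge $\{x_m,y_1\}$. For a simple graph $G$ on vertices $1,\dots,N$, let $R=\Bbbk[x_1,\dots,x_N]$ be the standard graded polynomial ring, $I(G)=(x_ix_j : \{i,j\}\text{ an edge of }G)$ its edge ideal, and $A(G)=R/\big((x_1^2,\dots,x_N^2)+I(G)\big)$, a standard graded artinian algebra $A=\bigoplus_{j=0}^s [A]_j$. Such an $A$ has the weak Lefschetz property (WLP) if there is a linear form $\ell\in[A]_1$ such that multiplication $\times\ell:[A]_j\to[A]_{j+1}$ is injective or surjective for every $j=0,\dots,s-1$. *)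

(* Defs.v *)
From HB Require Import structures.
From mathcomp Require Import all_boot all_order all_algebra.
From mathcomp Require Import mpoly.
Set Implicit Arguments. Unset Strict Implicit. Unset Printing Implicit Defensive.
Import GRing.Theory.

(* A simple graph on vertex set 'I_N is given by a boolean adjacency relation
   on nat (only values < N matter). *)

(* Tadpole graph T_{m,n} on vertices 0..m+n-1 (0-based):
   x_i  |-> i-1   (i = 1..m),   y_j |-> m+j-1  (j = 1..n).
   Edges: {x_i,x_{i+1}} (1<=i<=m-1), {x_m,x_1}, {y_j,y_{j+1}} (1<=j<=n-1),
   and the bridge {x_m,y_1}. *)
Definition tadpole_edge (m n : nat) (a b : nat) : bool := (
  [|| (a.+1 < m) && (b == a.+1)
    , (a == m.-1) && (b == 0)
    , (m <= a) && (a.+1 < m + n) && (b == a.+1)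
    | (a == m.-1) && (b == m) ])%N.

Definition tadpole_adj (m n : nat) (a b : nat) : bool :=
  tadpole_edge m n a b || tadpole_edge m n b a.

Local Open Scope ring_scope.
Section Artinian.
Variables (k : fieldType) (N : nat) (adj : nat -> nat -> bool).

Definition gens_A : seq {mpoly k[N]} :=
  [seq 'X_i ^+ 2 | i <- enum 'I_N] ++
  map (fun ij : 'I_N * 'I_N => 'X_(ij.1) * 'X_(ij.2))
    (filter (fun ij : 'I_N * 'I_N => adj (val ij.1) (val ij.2)) (enum {: 'I_N * 'I_N})).

Definition in_J (f : {mpoly k[N]}) : Prop :=
  exists c : seq {mpoly k[N]}, size c = size gens_A /\
    f = \sum_(i < size gens_A) c`_i * gens_A`_i.

(* multiplication by l : [A]_j -> [A]_{j+1}, with [A]_j = [R]_j / [J]_j *)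
Definition mul_injective (l : {mpoly k[N]}) (j : nat) : Prop :=
  forall f : {mpoly k[N]}, f \is j.-homog -> in_J (l * f) -> in_J f.

Definition mul_surjective (l : {mpoly k[N]}) (j : nat) : Prop :=
  forall g : {mpoly k[N]}, g \is j.+1.-homog ->
    exists f : {mpoly k[N]}, f \is j.-homog /\ in_J (g - l * f).

(* weak Lefschetz property of A(G); a linear form of [A]_1 is the class of
   sum_i a_i x_i.  The condition is imposed for all degrees j; for j >= s
   (the socle degree) [A]_{j+1} = 0 and surjectivity is automatic. *)
Definition has_WLP : Prop :=
  exists a : 'I_N -> k,
    let l := \sum_(i < N) a i *: 'X_i in
    forall j : nat, mul_injective l j \/ mul_surjective l j.

End Artinian.

(* Main.v *)
Require Import Defs.
From HB Require Import structures.
From mathcomp Require Import all_boot all_order all_algebra.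
From mathcomp Require Import mpoly zify.
Set Implicit Arguments. Unset Strict Implicit. Unset Printing Implicit Defensive.
Import GRing.Theory.
Local Open Scope ring_scope.

(** A(G) has the stable (independent) sets of G as a monomial basis, and by
    semicontinuity of the rank and the torus action one may take for l the sum
    of all the variables.

    Full rank: if l has full rank, on the same side, on A(G - x) in degree d and
    on A(G - N[x]) in degree d - 1, then it does on A(G) in degree d.  For
    n = 1, 2, 3, 5, 6, 9, well-chosen vertices x reduce every degree to edgeless
    graphs, where hard Lefschetz holds for k[x_1, ..., x_m]/(x_i^2), and to the
    5-cycle in degree 1.

    Failure: the remaining n are those of the form 4 + 3a + 4b.  Let c and p be
    the sums of the variables over the 5-cycle and over the first four y_j.  As
    c^3 = p^3 = 0, the form c^2 - cp + p^2 is killed by c + p.  Multiplying it by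
    the middle variable of each of a further blocks P_3, and by
    z_1 + z_2 - z_3 - z_4 for each of b further blocks P_4, gives a kernel element
    of degree 2 + a + b.  On the other hand t edges forming an induced matching
    give a nonzero functional on degree t that vanishes on the image of l, namely
    the product of the differences of the two coordinates of each edge; such a
    matching exists for t = 3 + a + b because 3t <= n + 5. *)

(** * Stable sets of a graph *)

Definition stable (I : finType) (e : rel I) (S : {set I}) : bool :=
  [forall i in S, forall j in S, ~~ e i j].

Lemma stableP (I : finType) (e : rel I) (S : {set I}) :
  reflect {in S &, forall i j, ~~ e i j} (stable e S).
Proof.
apply: (iffP forall_inP) => [h i j iS jS|h i iS].
  by have /forall_inP := h i iS; apply.
by apply/forall_inP => j jS; apply: h.
Qed.

Lemma stableS (I : finType) (e : rel I) (S T : {set I}) :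
  S \subset T -> stable e T -> stable e S.
Proof.
move=> /subsetP ST /stableP h; apply/stableP => i j iS jS.
exact: h (ST i iS) (ST j jS).
Qed.

Definition ord_rel (N : nat) (adj : nat -> nat -> bool) : rel 'I_N :=
  fun i j => adj i j.

(** * Membership in the defining ideal, read off coefficients *)

Section Coefficients.
Variables (k : fieldType) (N : nat) (adj : nat -> nat -> bool).
Hypothesis adj_irr : irreflexive adj.

Let e : rel 'I_N := ord_rel adj.
Let gens := gens_A k N adj.
Implicit Types (f g : {mpoly k[N]}) (S T : {set 'I_N}) (m : 'X_{1..N}).

Lemma gens_A_monomial g : g \in gens ->
  exists2 m, g = 'X_[m] & forall S, stable e S -> ~~ (m <= mesym1 S)%MM.
Proof.
rewrite mem_cat => /orP[|] /mapP[] => [i _|[i j]].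
  move=> ->; exists (U_(i) *+ 2)%MM; first by rewrite mpolyXn.
  move=> S _; apply/negP => /mnm_lepP/(_ i).
  by rewrite mulmnE !mnmE eqxx /=; case: (i \in S).
rewrite mem_filter /= => /andP[aij _] ->.
exists (U_(i) + U_(j))%MM; first by rewrite mpolyXD.
move=> S /stableP st; apply/negP => /mnm_lepP le.
have iS : i \in S.
  by have := le i; rewrite !mnmE eqxx /=; case: (i \in S).
have jS : j \in S.
  by have := le j; rewrite !mnmE eqxx addnC /=; case: (j \in S).
by have /negP := st i j iS jS; apply.
Qed.

Lemma mcoeffMX_eq0 f m1 m2 : ~~ (m1 <= m2)%MM -> (f * 'X_[m1])@_m2 = 0.
Proof.
move=> nle; apply/eqP; rewrite mcoeff_eq0 (perm_mem (msuppMX f m1)).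
apply/negP => /mapP[m' _ m2E]; case/negP: nle.
by apply/mnm_lepP => i; rewrite m2E mnmDE leq_addr.
Qed.

Lemma in_J0 : in_J adj (0 : {mpoly k[N]}).
Proof.
exists (nseq (size gens) 0); rewrite size_nseq; split => //.
by rewrite big1 // => i _; rewrite nth_nseq if_same mul0r.
Qed.

Lemma in_JD f g : in_J adj f -> in_J adj g -> in_J adj (f + g).
Proof.
move=> [c [cs ->]] [d [ds ->]].
exists (mkseq (fun i => c`_i + d`_i) (size gens)); rewrite size_mkseq.
split=> //; rewrite -big_split; apply: eq_bigr => i _ /=.
by rewrite nth_mkseq // mulrDl.
Qed.

Lemma in_J_sum (K : eqType) (r : seq K) (F : K -> {mpoly k[N]}) :
  (forall x, x \in r -> in_J adj (F x)) -> in_J adj (\sum_(x <- r) F x).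
Proof.
by move=> h; rewrite big_seq; elim/big_ind: _; [exact: in_J0 | exact: in_JD |].
Qed.

Lemma in_JMgen f g : g \in gens -> in_J adj (f * g).
Proof.
move=> gG; exists (mkseq (fun i => if i == index g gens then f else 0) (size gens)).
rewrite size_mkseq; split=> //.
have iG : (index g gens < size gens)%N by rewrite index_mem.
rewrite (bigD1 (Ordinal iG)) //= nth_mkseq // eqxx nth_index // big1 ?addr0 //.
move=> i; rewrite -val_eqE /= => /negPf ni.
by rewrite nth_mkseq // ni mul0r.
Qed.

Lemma in_JMX m f : in_J adj ('X_[m] : {mpoly k[N]}) -> in_J adj (f * 'X_[m]).
Proof.
move=> [c [cs ->]].
rewrite mulr_sumr; apply: in_J_sum => i _.
by rewrite mulrA; apply: in_JMgen; rewrite mem_nth.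
Qed.

(** Such a monomial is divisible by the square of a variable, or it is squarefree with an edge in
    its support. Irreflexivity makes the two ends of that edge distinct, so that the product of
    their variables divides it. *)
Lemma in_JX_unstable m :
  (forall S, stable e S -> m != mesym1 S) -> in_J adj ('X_[m] : {mpoly k[N]}).
Proof.
move=> nm; have [/existsP[i mi]|/existsPn m1] := boolP [exists i, (1 < m i)%N].
  rewrite -(@submK _ (U_(i) *+ 2)%MM m) ?mpolyXD -?mpolyXn.
    apply: in_JMgen; rewrite mem_cat; apply/orP; left.
    by apply/mapP; exists i; rewrite ?mem_enum.
  apply/mnm_lepP => j; rewrite mulmnE mnmE.
  by case: eqP => // <-; rewrite mul1n.
pose S := [set i | m i == 1%N].
have mS : m = mesym1 S.
  apply/mnmP => i; rewrite mnmE inE; have := m1 i.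
  by rewrite -leqNgt; case: (m i) => [|[]].
have [st|] := boolP (stable e S).
  by have := nm S st; rewrite mS eqxx.
move=> /forall_inPn[i iS /forall_inPn[j jS]]; rewrite negbK => eij.
have nij : i != j by apply/eqP => ij; move: eij; rewrite ij /e /ord_rel adj_irr.
rewrite -(@submK _ (U_(i) + U_(j))%MM m) ?mpolyXD.
  apply: in_JMgen; rewrite mem_cat; apply/orP; right.
  by apply/mapP; exists (i, j) => //; rewrite mem_filter /= mem_enum andbT.
apply/mnm_lepP => l; rewrite mS !mnmE.
case: eqP => [<-|_]; first by rewrite iS eq_sym (negPf nij).
by case: eqP => [<-|//]; rewrite jS.
Qed.

(** The ideal is monomial, and the monomials outside it are exactly the squarefree ones with stable
    support. *)
Lemma in_JP f : in_J adj f <-> (forall S, stable e S -> f@_(mesym1 S) = 0).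
Proof.
split=> [[c [cs ->]] S st|h].
  rewrite raddf_sum big1 //= => i _.
  have /gens_A_monomial[m -> nle] : gens`_i \in gens by rewrite mem_nth.
  exact: mcoeffMX_eq0 (nle S st).
rewrite [f]mpolyE; apply: in_J_sum => m mf.
rewrite -mul_mpolyC; apply/in_JMX/in_JX_unstable => S st.
by apply: contraTneq mf => ->; rewrite mcoeff_msupp h // eqxx.
Qed.

Definition linform (a : 'I_N -> k) : {mpoly k[N]} := \sum_(i < N) a i *: 'X_i.

Lemma mcoeff_linformM a f T :
  (linform a * f)@_(mesym1 T) = \sum_(i in T) a i * f@_(mesym1 (T :\ i)).
Proof.
rewrite mulr_suml raddf_sum /= [RHS]big_mkcond; apply: eq_bigr => i _.
rewrite -scalerAl mcoeffZ [_ * f]mulrC; case: ifPn => iT.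
  have -> : mesym1 T = (U_(i) + mesym1 (T :\ i))%MM.
    apply/mnmP => j; rewrite !mnmE !inE eq_sym.
    by case: (altP (j =P i)) => [->|]; rewrite ?iT.
  by rewrite mcoeffMX.
rewrite mcoeffMX_eq0 ?mulr0 //; apply/negP => /mnm_lepP/(_ i).
by rewrite !mnmE eqxx (negPf iT).
Qed.

End Coefficients.

(** * Multiplication matrices and generic linear forms *)

Section Lefschetz.
Variables (k : fieldType) (I : finType) (e : rel I).
Implicit Types (S T A : {set I}) (v phi : {set I} -> k) (a : I -> k).

Definition slice (d : nat) : {set {set I}} := [set S | stable e S & #|S| == d].

(** Matrix of multiplication by the form with coefficients [a], from degree [d] to [d.+1], in the
    bases of stable sets and acting on row vectors. The inner sum has at most one term. *)
Definition incidence a (d : nat) : 'M[k]_(#|slice d|, #|slice d.+1|) :=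
  \matrix_(p, q) let T : {set I} := enum_val q in
                 \sum_(i in T | T :\ i == enum_val p) a i.

Lemma row_of_fun (X : {set {set I}}) (u : 'rV[k]_#|X|) :
  exists2 v, (forall S, S \notin X -> v S = 0) & u = \row_p v (enum_val p).
Proof.
exists (fun S => if [pick p | enum_val p == S] is Some p then u 0 p else 0).
  by move=> S; case: pickP => // p /eqP <-; rewrite enum_valP.
apply/rowP => p; rewrite mxE; case: pickP => [q /eqP/enum_val_inj -> //|/(_ p)].
by rewrite eqxx.
Qed.

Lemma slice_setD1 d T i : T \in slice d.+1 -> i \in T -> T :\ i \in slice d.
Proof.
rewrite !inE => /andP[st /eqP cT] iT.
rewrite (stableS (subD1set _ _) st) /=.
by move: cT; rewrite (cardsD1 i) iT add1n => -[->].
Qed.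

Lemma mul_incidence a d v (q : 'I_#|slice d.+1|) (T : {set I} := enum_val q) :
  ((\row_p v (enum_val p)) *m incidence a d) 0 q =
  \sum_(i in T) a i * v (T :\ i).
Proof.
rewrite mxE.
have TS : T \in slice d.+1 by apply: enum_valP.
transitivity (\sum_(S in slice d) \sum_(i in T | T :\ i == S) a i * v S).
  rewrite [RHS]big_enum_val; apply: eq_bigr => p _.
  by rewrite !mxE mulrC mulr_suml.
rewrite (exchange_big_dep (mem T)) /=; last by move=> S i _ /andP[].
apply: eq_bigr => i iT; rewrite (big_pred1 (T :\ i)) // => S.
by rewrite iT /= andbC eq_sym; case: eqP => // ->; rewrite slice_setD1.
Qed.

Lemma incidence_mul a d phi (p : 'I_#|slice d|) (S : {set I} := enum_val p) :
  (forall T, T \notin slice d.+1 -> phi T = 0) ->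
  (incidence a d *m (\col_q phi (enum_val q))) p 0 =
  \sum_(i | i \notin S) a i * phi (i |: S).
Proof.
move=> supp; rewrite mxE.
transitivity (\sum_(T in slice d.+1) \sum_(i in T | T :\ i == S) a i * phi T).
  rewrite [RHS]big_enum_val; apply: eq_bigr => q _.
  by rewrite !mxE mulr_suml.
rewrite (exchange_big_dep (fun i => i \notin S)) /=; last first.
  by move=> T i _ /andP[_ /eqP <-]; rewrite !inE eqxx.
apply: eq_bigr => i iS.
have [h|h] := boolP (i |: S \in slice d.+1); last first.
  rewrite (supp _ h) mulr0 big1 // => T /and3P[TS iT /eqP ES].
  by case/negP: h; rewrite -ES setD1K.
rewrite (big_pred1 (i |: S)) // => T.
apply/and3P/eqP => [[_ iT /eqP <-]|->]; first by rewrite setD1K.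
by rewrite h !inE eqxx setU1K.
Qed.

Lemma incidenceDZ a b t d :
  incidence (fun i => a i + t * b i) d = incidence a d + t *: incidence b d.
Proof. by apply/matrixP => p q; rewrite !mxE mulr_sumr -big_split. Qed.

(** The substitution of [a i] times x_i for x_i carries the sum of the variables to the form with
    coefficients [a]; it is diagonal on monomials. *)
Lemma incidence_scale a d :
  diag_mx (\row_p \prod_(i in (enum_val p : {set I})) a i) *m incidence a d =
  incidence (fun=> 1) d *m diag_mx (\row_q \prod_(i in (enum_val q : {set I})) a i).
Proof.
apply/matrixP => p q; rewrite mul_diag_mx mul_mx_diag !mxE mulr_suml mulr_sumr.
apply: eq_bigr => i /andP[iT /eqP <-].
by rewrite mul1r [RHS](big_setD1 i) //= mulrC.
Qed.

Lemma diag_mx_unit n (c : 'rV[k]_n) : (forall i, c 0 i != 0) -> diag_mx c \in unitmx.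
Proof.
by move=> c0; rewrite unitmxE det_diag unitfE; apply/prodf_neq0 => i _.
Qed.

Lemma rank_incidence_torus a d : (forall i, a i != 0) ->
  \rank (incidence a d) = \rank (incidence (fun=> 1) d).
Proof.
move=> a0; have unit n (F : 'I_n -> {set I}) :
    diag_mx (\row_p \prod_(i in F p) a i) \in unitmx.
  by apply: diag_mx_unit => p; rewrite mxE; apply/prodf_neq0.
have /(congr1 mxrank) := incidence_scale a d.
rewrite [in RHS]mxrankMfree ?row_free_unit ?unit // => <-.
by rewrite eqmxMfull ?row_full_unit ?unit.
Qed.

Hypothesis char0 : [pchar k] =i pred0.

Lemma natr_inj_pchar0 : injective (fun n : nat => n%:R : k).
Proof.
move=> m n /= /eqP; wlog le : m n / (m <= n)%N => [hw|].
  by case/orP: (leq_total m n) => le /eqP h; [|symmetry]; apply: hw le _; apply/eqP.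
by rewrite eq_sym -subr_eq0 -natrB // ((pcharf0P k).1 char0) subn_eq0 => h; apply/eqP; rewrite eqn_leq le.
Qed.

Lemma poly_nonroot (p : {poly k}) : p != 0 -> exists t, p.[t] != 0.
Proof.
move=> p0; pose r := [seq i%:R : k | i <- iota 0 (size p)].
have ur : uniq r by rewrite map_inj_uniq ?iota_uniq //; exact: natr_inj_pchar0.
have [/(max_poly_roots p0)/(_ ur)|/allPn[t _ tp]] := boolP (all (root p) r).
  by rewrite size_map size_iota ltnn.
by exists t.
Qed.

(* Rank is lower semicontinuous along the line [a + t * (1, ..., 1)], a generic
   point of which lies in the torus. *)
Lemma rank_incidence_le a d :
  (\rank (incidence a d) <= \rank (incidence (fun=> 1%R) d))%N.
Proof.
set M := incidence a d; set M1 := incidence _ d.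
(* One-sided inverses of the factors of a rank factorization compress [M] to the identity of size
   [\rank M]. *)
have [C CE] := row_fullP (col_base_full M).
have [B BE] := row_freeP (row_base_free M).
have CMB : C *m M *m B = 1%:M.
  suff -> : C *m M = row_base M by [].
  by rewrite -[LHS](congr1 (mulmx C) (mulmx_base M)) mulmxA CE mul1mx.
pose P := \det (map_mx polyC (C *m M *m B) + 'X *: map_mx polyC (C *m M1 *m B)).
have PE t : P.[t] = \det (C *m (M + t *: M1) *m B).
  rewrite -[P.[t]]/(horner_eval t P) -det_map_mx; congr (\det _).
  rewrite mulmxDr mulmxDl -scalemxAr -scalemxAl.
  move: (C *m M *m B) (C *m M1 *m B) => X X1.
  by apply/matrixP => i j; rewrite !mxE /= /horner_eval !hornerE.
(* [P] is nonzero since its value at 0 is 1. The other factor makes every [a i + t] nonzero at a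
   nonroot [t] of [Q]. *)
pose Q := P * \prod_i ('X + (a i)%:P).
have [|t] := @poly_nonroot Q.
  rewrite mulf_neq0 //.
    apply: contra_eq_neq (PE 0) => ->.
    by rewrite scale0r addr0 CMB det1 horner0 eq_sym oner_neq0.
  by apply/prodf_neq0 => i _; rewrite -size_poly_eq0 size_XaddC.
rewrite hornerM mulf_eq0 negb_or PE horner_prod => /andP[dt /prodf_neq0 at0].
rewrite -(@rank_incidence_torus (fun i => a i + t * 1)) => [|i]; last first.
  by have := at0 i isT; rewrite mulr1 !hornerE addrC.
rewrite incidenceDZ -/M -/M1.
have: C *m (M + t *: M1) *m B \in unitmx by rewrite unitmxE unitfE.
move/mxrank_unit => {1}<-.
by apply: leq_trans (mxrankM_maxl _ _) (mxrankM_maxr _ _).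
Qed.

(** On coefficient functions [down] is multiplication by the sum of the variables; [up] is its
    transpose, acting on functionals. *)
Definition down v T : k := \sum_(i in T) v (T :\ i).
Definition up phi S : k := \sum_(i | i \notin S) phi (i |: S).

Definition inj_on A d := forall v,
  (forall T, T \subset A -> T \in slice d.+1 -> down v T = 0) ->
  forall S, S \subset A -> S \in slice d -> v S = 0.

(** Surjectivity in dual form: a functional that vanishes on the image is zero. Here [d] is the
    target degree, whereas in [inj_on] it is the source degree. *)
Definition surj_on A d := forall phi,
  (forall T, ~~ (T \subset A) || (T \notin slice d) -> phi T = 0) ->
  (forall S, up phi S = 0) -> forall T, phi T = 0.

Lemma row_free_incidence d : row_free (incidence (fun=> 1) d) <-> inj_on setT d.
Proof.
split=> [free v h S _ Sd|inj].
  have /eqP : (\row_p v (enum_val p) : 'rV_#|slice d|) == 0.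
    rewrite -(mulmx_free_eq0 _ free); apply/eqP.
    apply/rowP => q; rewrite mul_incidence [RHS]mxE.
    rewrite -[RHS](h (enum_val q)) ?subsetT ?enum_valP //.
    by apply: eq_bigr => i _; rewrite mul1r.
  move/rowP/(_ (enum_rank_in Sd S)); rewrite !mxE.
  by rewrite enum_rankK_in.
apply: inj_row_free => u u0; have [v _ uE] := row_of_fun u.
apply/rowP => p; rewrite uE !mxE; apply: inj; rewrite ?subsetT ?enum_valP //.
move=> T _ Td; have /rowP/(_ (enum_rank_in Td T)) := u0.
rewrite uE mul_incidence [RHS]mxE enum_rankK_in // => <-.
by apply: eq_bigr => i _; rewrite mul1r.
Qed.

Lemma row_full_incidence d :
  row_full (incidence (fun=> 1) d) <-> surj_on setT d.+1.
Proof.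
have -> : row_full (incidence (fun=> 1) d) = row_free (incidence (fun=> 1) d)^T.
  by rewrite /row_full /row_free mxrank_tr.
split=> [free phi supp h T|surj].
  have [Td|nTd] := boolP (T \in slice d.+1); last by rewrite supp ?nTd ?orbT.
  have /eqP : (\col_q phi (enum_val q) : 'cV_#|slice d.+1|)^T == 0.
    rewrite -(mulmx_free_eq0 _ free) -trmx_mul; apply/eqP.
    apply/rowP => p; rewrite [LHS]mxE incidence_mul => [|S Sd]; last first.
      by rewrite supp ?Sd ?orbT.
    rewrite [RHS]mxE -[RHS](h (enum_val p)).
    by apply: eq_bigr => i _; rewrite mul1r.
  move/rowP/(_ (enum_rank_in Td T)); rewrite !mxE.
  by rewrite enum_rankK_in.
apply: inj_row_free => u u0; have [phi supp rE] := row_of_fun u.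
have uE : u = (\col_p phi (enum_val p))^T by rewrite rE; apply/rowP => p; rewrite !mxE.
apply/rowP => p; rewrite uE !mxE; apply: surj => [T|S].
  by rewrite subsetT; apply: supp.
have [Sd|nSd] := boolP (S \in slice d); last first.
  apply: big1 => i iS; apply: supp; apply: contra nSd => /slice_setD1/(_ (setU11 i S)).
  by rewrite setU1K.
have /rowP/(_ (enum_rank_in Sd S)) := u0.
rewrite uE -trmx_mul [LHS]mxE incidence_mul // [RHS]mxE enum_rankK_in // => <-.
by apply: eq_bigr => i _; rewrite mul1r.
Qed.

End Lefschetz.

(** * The weak Lefschetz property in terms of the sum of the variables *)

Section WLP.
Variables (k : fieldType) (N : nat) (adj : nat -> nat -> bool).
Hypothesis adj_irr : irreflexive adj.
Let e : rel 'I_N := ord_rel adj.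
Let slice := slice e.
Implicit Types (f g : {mpoly k[N]}) (S T : {set 'I_N}).
Implicit Types (v : {set 'I_N} -> k) (a : 'I_N -> k).

Definition sqfree_poly v d : {mpoly k[N]} :=
  \sum_(S in slice d) v S *: 'X_[mesym1 S].

Lemma sqfree_poly_homog v d : sqfree_poly v d \is d.-homog.
Proof.
apply: rpred_sum => S; rewrite inE => /andP[_ /eqP cS].
by apply: rpredZ; rewrite dhomogX /= mdeg_mesym1 cS.
Qed.

Lemma mcoeff_sqfree_poly v d T :
  (sqfree_poly v d)@_(mesym1 T) = if T \in slice d then v T else 0.
Proof.
rewrite raddf_sum /=; under eq_bigr do rewrite mcoeffZ mcoeffX (inj_eq (@inj_mesym1 _)).
case: ifPn => [Td|nT].
  rewrite (bigD1 T) //= eqxx mulr1 big1 ?addr0 // => S /andP[_ /negPf ->].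
  by rewrite mulr0.
by apply: big1 => S Sd; case: eqP nT => [<-|]; rewrite ?Sd ?mulr0.
Qed.

Lemma mcoeff_homog_slice f d T :
  f \is d.-homog -> stable e T -> T \notin slice d -> f@_(mesym1 T) = 0.
Proof.
move=> hf st; rewrite inE st /= => nT.
by apply: dhomog_nemf_coeff hf _; rewrite /= mdeg_mesym1.
Qed.

Lemma linformM_slice a f d T : f \is d.-homog -> stable e T -> T \notin slice d.+1 ->
  (linform a * f)@_(mesym1 T) = 0.
Proof.
move=> hf st nT; rewrite mcoeff_linformM big1 // => i iT.
rewrite (mcoeff_homog_slice hf) ?mulr0 ?(stableS (subD1set _ _) st) //.
apply: contra nT; rewrite !inE st => /andP[_ /eqP <-].
by rewrite (cardsD1 i T) iT add1n eqxx.
Qed.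

Lemma mul_injective_row_free a d :
  mul_injective adj (linform a) d <-> row_free (incidence e a d).
Proof.
split=> [inj|free f hf /in_JP J].
  apply: inj_row_free => u u0; have [v _ uE] := row_of_fun u.
  have /in_JP J : in_J adj (sqfree_poly v d).
    apply: inj; rewrite ?sqfree_poly_homog //; apply/in_JP => // T st.
    have [Td|nTd] := boolP (T \in slice d.+1); last first.
      by rewrite (linformM_slice _ (sqfree_poly_homog _ _)).
    have /rowP/(_ (enum_rank_in Td T)) := u0.
    rewrite uE mul_incidence [RHS]mxE enum_rankK_in // mcoeff_linformM => E.
    by rewrite -[RHS]E; apply: eq_bigr => i iT; rewrite mcoeff_sqfree_poly (slice_setD1 Td).
  apply/rowP => p; rewrite uE !mxE.
  have pd : enum_val p \in slice d by apply: enum_valP.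
  have st : stable e (enum_val p) by move: pd; rewrite inE => /andP[].
  by have := J adj_irr _ st; rewrite mcoeff_sqfree_poly pd.
apply/in_JP => // S st.
have [Sd|nSd] := boolP (S \in slice d); last exact: mcoeff_homog_slice hf st nSd.
have /eqP : (\row_p f@_(mesym1 (enum_val p)) : 'rV_#|slice d|) == 0.
  rewrite -(mulmx_free_eq0 _ free); apply/eqP/rowP => q.
  rewrite (mul_incidence _ (fun S => f@_(mesym1 S))) [RHS]mxE -mcoeff_linformM.
  apply: J => //; have := enum_valP q.
  by rewrite inE => /andP[].
move/rowP/(_ (enum_rank_in Sd S)); rewrite !mxE.
by rewrite enum_rankK_in.
Qed.

Lemma mul_surjective_row_full a d :
  mul_surjective adj (linform a) d <-> row_full (incidence e a d).
Proof.
split=> [surj|full g hg].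
  rewrite -sub1mx; apply/row_subP => q0.
  have [f [hf /in_JP J]] := surj _ (sqfree_poly_homog
    (fun T => (T == enum_val q0)%:R) d.+1).
  apply/submxP; exists (\row_p f@_(mesym1 (enum_val p))).
  apply/rowP => q; rewrite (mul_incidence _ (fun S => f@_(mesym1 S))).
  have qd : enum_val q \in slice d.+1 by apply: enum_valP.
  have st : stable e (enum_val q) by move: qd; rewrite inE => /andP[].
  have /eqP := J adj_irr _ st.
  rewrite mcoeffB mcoeff_sqfree_poly qd subr_eq0 mcoeff_linformM => /eqP <-.
  by rewrite !mxE (inj_eq enum_val_inj) eq_sym.
have [B BE] := row_fullP full.
pose u := (\row_q g@_(mesym1 (enum_val q)) : 'rV_#|slice d.+1|) *m B.
have [v _ uE] := row_of_fun u.
exists (sqfree_poly v d); split; first exact: sqfree_poly_homog.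
apply/in_JP => // T st; rewrite mcoeffB.
have [Td|nTd] := boolP (T \in slice d.+1); last first.
  by rewrite (mcoeff_homog_slice hg) // (linformM_slice _ (sqfree_poly_homog _ _)) // subrr.
have /rowP/(_ (enum_rank_in Td T)) : u *m incidence e a d =
  \row_q g@_(mesym1 (enum_val q)) by rewrite -mulmxA BE mulmx1.
rewrite uE mul_incidence [in RHS]mxE enum_rankK_in // => <-.
rewrite mcoeff_linformM; apply/eqP; rewrite subr_eq0; apply/eqP.
by apply: eq_bigr => i iT; rewrite mcoeff_sqfree_poly (slice_setD1 Td).
Qed.

(** No linear form has larger rank than the sum of the variables in any degree, so that single form
    serves all degrees at once. *)
Lemma has_WLP_incidence : [pchar k] =i pred0 ->
  has_WLP k N adj <-> forall d, inj_on k e setT d \/ surj_on k e setT d.+1.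
Proof.
move=> char0; split=> [[a WLP] d|h].
  case: (WLP d) => [/mul_injective_row_free|/mul_surjective_row_full] full.
    left; apply/row_free_incidence; rewrite /row_free eqn_leq rank_leq_row.
    by rewrite -{1}(eqP full) (rank_incidence_le e char0).
  right; apply/row_full_incidence; rewrite /row_full eqn_leq rank_leq_col.
  by rewrite -{1}(eqP full) (rank_incidence_le e char0).
exists (fun=> 1) => l d; case: (h d) => [/row_free_incidence|/row_full_incidence] full.
  by left; apply/mul_injective_row_free.
by right; apply/mul_surjective_row_full.
Qed.

End WLP.

(** * Full rank by vertex deletion, and its base cases *)

Section FullRank.
Variables (k : fieldType) (I : finType) (e : rel I).
Hypotheses (e_irr : irreflexive e) (e_sym : ssrbool.symmetric e).
Implicit Types (S T A : {set I}) (v phi : {set I} -> k) (x : I).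

Lemma stableU1 x T : stable e (x |: T) = stable e T && [forall y in T, ~~ e x y].
Proof.
apply/idP/andP => [st|[/stableP st /forall_inP xT]].
  split; first by apply: stableS st; apply: subsetUr.
  by apply/forall_inP => y yT; apply: (stableP _ _ st); rewrite !inE ?eqxx ?yT ?orbT.
apply/stableP => i j; rewrite !inE => /orP[/eqP ->|iT] /orP[/eqP ->|jT].
- by rewrite e_irr.
- exact: xT.
- by rewrite e_sym xT.
- exact: st.
Qed.

Lemma slice_setU1 d x T : x |: T \in slice e d.+1 -> x \notin T -> T \in slice e d.
Proof. by move=> /slice_setD1/(_ (setU11 x T)) h xT; rewrite setU1K in h. Qed.

Lemma down_setU1 v x T : x \notin T ->
  down v (x |: T) = v T + down (fun S => v (x |: S)) T.
Proof.
move=> xT; rewrite /down big_setU1 //= setU1K //; congr (_ + _).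
apply: eq_bigr => i iT; congr v; apply/setP => y; rewrite !inE.
by case: eqP => // ->; case: eqP iT xT => [->|] // ->.
Qed.

Definition nbhd x : {set I} := x |: [set y | e x y].

(** The multiples of x in A(G) form a copy of A(G - N[x]) shifted by one degree, with quotient A(G -
    x). Multiplication respects this exact sequence, and injectivity at both ends gives it in the
    middle. *)
Lemma inj_on_split A d x :
  inj_on k e (A :\ x) d -> (forall d', d = d'.+1 -> inj_on k e (A :\: nbhd x) d') ->
  inj_on k e A d.
Proof.
move=> injD injN v h.
have v0 S : S \subset A -> x \notin S -> S \in slice e d -> v S = 0.
  move=> SA xS; apply: injD; last by rewrite subsetD1 SA.
  by move=> T /subset_trans TA; apply: h; apply/TA/subsetDl.
move=> S SA Sd; have [xS|] := boolP (x \in S); last by move/v0 ->.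
have [d' dE] : exists d', d = d'.+1.
  by exists #|S :\ x|; move: Sd; rewrite inE => /andP[_ /eqP <-]; rewrite (cardsD1 x) xS.
subst d; rewrite -(setD1K xS).
apply: (injN d' erefl (fun S => v (x |: S))); last by rewrite (slice_setD1 Sd).
  move=> T TA Td.
  have xT : x \notin T.
    by apply/negP => /(subsetP TA); rewrite !inE eqxx.
  have TA' : T \subset A by apply: subset_trans TA (subsetDl _ _).
  have xA : x \in A by apply: (subsetP SA).
  have <- := h (x |: T); first by rewrite down_setU1 // v0 // add0r.
    by rewrite subUset sub1set xA.
  move: Td; rewrite !inE stableU1 => /andP[-> /eqP cT] /=.
  rewrite cardsU1 xT cT eqxx andbT; apply/forall_inP => y /(subsetP TA).
  by rewrite !inE negb_or => /andP[/andP[]].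
apply/subsetP => y; rewrite !inE => /andP[yx yS].
rewrite (negPf yx) (subsetP SA) // andbT.
by move: Sd; rewrite inE => /andP[/stableP st _]; apply: st.
Qed.

(** Same exact sequence, dually: a functional vanishing on the image restricts to zero on the
    multiples of x, hence descends to A(G - x). *)
Lemma surj_on_split A d x :
  surj_on k e (A :\ x) d -> (forall d', d = d'.+1 -> surj_on k e (A :\: nbhd x) d') ->
  surj_on k e A d.
Proof.
move=> surjD surjN phi supp h.
have phix T : x \in T -> phi T = 0.
  move=> xT; have [d0|[d' dE]] : d = 0%N \/ exists d', d = d'.+1.
    by case: (d) => [|d']; [left|right; exists d'].
    apply: supp; rewrite inE d0 cards_eq0; case: eqP => [T0|]; last by rewrite andbF orbT.
    by rewrite T0 inE in xT.
  rewrite -(setD1K xT); subst d.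
  pose psi S := if x \in S then 0 else phi (x |: S).
  have : psi (T :\ x) = 0; last by rewrite /psi !inE eqxx.
  apply: (surjN d' erefl) => [S out|S]; rewrite /psi.
    case: ifPn => // xS; apply/eqP; apply: contraTT out => nz.
    have /norP[] : ~~ (~~ (x |: S \subset A) || (x |: S \notin slice e d'.+1)).
      by apply: contra nz => /supp ->.
    rewrite !negbK => SA Sd; rewrite negb_or !negbK (slice_setU1 Sd xS) andbT.
    apply/subsetP => y yS; rewrite !inE (subsetP SA) ?inE ?yS ?orbT // andbT.
    rewrite negb_or; apply/andP; split; first by apply: contraNneq xS => <-.
    by move: Sd; rewrite inE stableU1 => /andP[/andP[_ /forall_inP/(_ y yS)]].
  have [xS|xS] := boolP (x \in S).
    by apply: big1 => i _; rewrite inE xS orbT.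
  rewrite -[RHS](h (x |: S)) /up (bigD1 x) //= setU11 add0r.
  apply: eq_big => [i|i /andP[iS ix]]; first by rewrite !inE negb_or andbC.
  by rewrite !inE eq_sym (negPf ix) (negPf xS) setUCA.
apply: surjD => // T; rewrite subsetD1 negb_and negbK -orbA => /or3P[TA|xT|Td].
- by apply: supp; rewrite TA.
- exact: phix.
- by apply: supp; rewrite Td orbT.
Qed.

Lemma iter_down_eq0 n v T :
  (forall S, S \subset T -> (#|S| + n)%N = #|T| -> v S = 0) -> iter n (@down k I) v T = 0.
Proof.
elim: n T => [|n IHn] T v0; first by apply: v0; rewrite ?addn0.
apply: big1 => i iT; apply: IHn => S ST cS; apply: v0.
  exact: subset_trans ST (subD1set _ _).
by rewrite (cardsD1 i T) iT -cS addnS.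
Qed.

(** This is (x + l)^(n+1) = l^(n+1) + (n+1) x l^n, valid because x^2 = 0. *)
Lemma iter_down_setU1 n v x T : x \notin T ->
  iter n.+1 (@down k I) v (x |: T) =
  iter n.+1 (@down k I) (fun S => v (x |: S)) T + n.+1%:R * iter n (@down k I) v T.
Proof.
elim: n T => [|n IHn] T xT; first by rewrite /= down_setU1 // mul1r addrC.
rewrite iterS down_setU1 //.
have -> : down (fun S => iter n.+1 (@down k I) v (x |: S)) T =
    iter n.+2 (@down k I) (fun S => v (x |: S)) T + n.+1%:R * iter n.+1 (@down k I) v T.
  rewrite [iter n.+2 _ _]iterS [in X in _ + X]iterS /down mulr_sumr -big_split.
  by apply: eq_bigr => i iT; rewrite IHn // inE (negPf xT) andbF.
by rewrite addrCA; congr (_ + _); rewrite -[n.+2]addn1 natrD mulrDl mul1r addrC.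
Qed.

Hypothesis char0 : [pchar k] =i pred0.

(* Hard Lefschetz for k[x_1, ..., x_m] / (x_1^2, ..., x_m^2), by adjoining the
   variables one at a time. *)
Lemma boolean_hard_lefschetz A n d v : #|A| = (d.*2 + n)%N ->
  (forall T, T \subset A -> #|T| = (d + n)%N -> iter n (@down k I) v T = 0) ->
  forall S, S \subset A -> #|S| = d -> v S = 0.
Proof.
move: {2}#|A| (erefl #|A|) => m; elim: m A n d v => [|m IHm] A [|n] d v cA AE h.
- by move=> S SA cS; apply: (h S SA); rewrite cS addn0.
- by lia.
- by move=> S SA cS; apply: (h S SA); rewrite cS addn0.
have /card_gt0P[x xA] : (0 < #|A|)%N by rewrite cA.
pose B := A :\ x; pose w S := v (x |: S).
have cB : #|B| = m by move: cA; rewrite (cardsD1 x) xA => -[].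
have BA : B \subset A by apply: subD1set.
have xB T : T \subset B -> x \notin T.
  by move=> TB; apply/negP => /(subsetP TB); rewrite !inE eqxx.
have step T : T \subset B -> #|T| = (d + n)%N ->
    iter n.+1 (@down k I) w T + n.+1%:R * iter n (@down k I) v T = 0.
  move=> TB cT; rewrite -iter_down_setU1 ?xB //; apply: h.
    by rewrite subUset sub1set xA (subset_trans TB).
  by rewrite cardsU1 xB // cT addnS.
(* Write l for the sum of the variables in [B]. One more multiplication by l in [step] turns the
   term in [v] into a multiple of l^(n+1) v, which [h] kills on subsets of [B]. So l^(n+2) w = 0,
   where [w] has degree d - 1 in 2(d - 1) + (n + 2) variables. *)
have w0 S : S \subset B -> #|S|.+1 = d -> w S = 0.
  move=> SB; case: d => // d in AE h step * => -[cS].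
  apply: (IHm B n.+2 d w cB _ _ S SB cS); first by rewrite cB; lia.
  move=> T TB cT; rewrite iterS.
  have -> : down (iter n.+1 (@down k I) w) T =
      - n.+1%:R * down (iter n (@down k I) v) T.
    rewrite /down mulr_sumr; apply: eq_bigr => i iT.
    have TiB : T :\ i \subset B by apply: subset_trans (subD1set _ _) TB.
    have := step _ TiB; rewrite mulNr => /(_ _)/eqP; rewrite addr_eq0 => E.
    by apply/eqP/E; move: cT; rewrite (cardsD1 i) iT; lia.
  rewrite -iterS h ?mulr0 //; first exact: subset_trans TB BA.
  by rewrite cT; lia.
(* With [w] gone, [step] leaves (n + 1) l^n v = 0 in 2d + n variables. *)
have v0 S : S \subset B -> #|S| = d -> v S = 0.
  apply: (IHm B n d v) => //; first by rewrite cB; lia.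
  move=> T TB cT; have /eqP := step T TB cT.
  rewrite iter_down_eq0 => [|U UT cU]; last first.
    by apply: w0; [exact: subset_trans UT TB | lia].
  by rewrite add0r mulf_eq0 ((pcharf0P k).1 char0) => /eqP.
move=> S SA cS; have [xS|xS] := boolP (x \in S).
  rewrite -(setD1K xS); apply: w0; first exact: setSD.
  by rewrite -cS (cardsD1 x S) xS.
by apply: v0 => //; rewrite subsetD1 SA.
Qed.

(** The power of l with exponent |A| - 2d is injective on degree [d]; as the exponent is positive, l
    itself is injective there. *)
Lemma inj_on_stable A d : stable e A -> (d.*2 < #|A|)%N -> inj_on k e A d.
Proof.
move=> st dA v h S SA; rewrite inE => /andP[_ /eqP].
apply: (@boolean_hard_lefschetz A (#|A| - d.*2)) SA; first by lia.
case En : (#|A| - d.*2)%N => [|n]; first by lia.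
move=> T TA cT; rewrite iterSr; apply: iter_down_eq0 => U UT cU.
have UA : U \subset A by apply: subset_trans UT TA.
apply: (h U UA); rewrite inE (stableS UA st) /=; apply/eqP; lia.
Qed.

Lemma inj_on_card A d : (#|A| < d)%N -> inj_on k e A d.
Proof.
move=> Ad v _ S /subset_leq_card SA; rewrite inE => /andP[_ /eqP Sd].
by move: SA; rewrite Sd leqNgt Ad.
Qed.

Lemma surj_on_card A d : (#|A| < d)%N -> surj_on k e A d.
Proof.
move=> Ad phi supp _ T; apply: supp; apply/norP; rewrite !negbK => -[/subset_leq_card TA].
by rewrite inE => /andP[_ /eqP Td]; move: TA; rewrite Td leqNgt Ad.
Qed.

(* Complementation in [A] exchanges [up] and [down]. *)
Lemma surj_on_stable A d : stable e A -> (#|A| < d.*2)%N -> surj_on k e A d.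
Proof.
move=> st Ad; have [dA|] := leqP d #|A|; last exact: surj_on_card.
move=> phi supp h T.
have [TA|nTA] := boolP (T \subset A); last by rewrite supp ?nTA.
have [Td|nTd] := boolP (T \in slice e d); last by rewrite supp ?nTd ?orbT.
have inj : inj_on k e A (#|A| - d) by apply: inj_on_stable => //; lia.
have := inj (fun S => phi (A :\: S)) _ (A :\: T).
rewrite setDDr setDv set0U (setIidPr TA); apply; first 1 last.
- exact: subsetDl.
- rewrite inE (stableS (subsetDl _ _) st) cardsD (setIidPr TA) /=.
  by move: Td; rewrite inE => /andP[_ /eqP ->].
move=> S SA _; rewrite -[RHS](h (A :\: S)) /up (bigID (mem A)) /=.
rewrite [X in _ + X]big1 ?addr0 => [|i /andP[_ iA]]; last first.
  by rewrite supp // subUset sub1set (negPf iA).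
apply: eq_big => [i|i iS].
  by rewrite !inE negb_and negbK; case: (boolP (i \in S)) => [/(subsetP SA) ->|_]; case: (i \in A).
congr phi; apply/setP => y; rewrite !inE; case: eqP => //= ->.
by rewrite (subsetP SA).
Qed.

(* The coefficients of a cokernel functional alternate along the 5-cycle
   formed by the non-edges. *)
Lemma surj_on_C5 (x0 x1 x2 x3 x4 : I) (s := [:: x0; x1; x2; x3; x4]) :
  uniq s -> e x0 x1 -> e x1 x2 -> e x2 x3 -> e x3 x4 -> e x4 x0 ->
  surj_on k e [set x in s] 2.
Proof.
move=> us e01 e12 e23 e34 e40 phi supp h.
pose p x y := phi [set x; y].
have pC x y : p x y = p y x by rewrite /p setUC.
have pe x y : e x y -> p x y = 0.
  move=> exy; apply: supp; rewrite inE; case: stableP => [st|]; last by rewrite orbT.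
  by have := st x y; rewrite !inE !eqxx orbT exy => /(_ isT isT).
have upE x : \sum_(y <- s | y != x) p y x = 0.
  rewrite -[RHS](h [set x]) /up [RHS](bigID (mem [set y in s])) /=.
  rewrite [X in _ = _ + X]big1 ?addr0 => [|y /andP[_ ys]]; last first.
    by rewrite supp // subUset sub1set (negPf ys).
  rewrite -big_filter big_uniq ?filter_uniq //; apply: eq_bigl => y.
  by rewrite mem_filter in_set1 in_set.
have pE : [/\ p x0 x2 = 0, p x0 x3 = 0, p x1 x3 = 0, p x1 x4 = 0 & p x2 x4 = 0].
  move: us; rewrite /= !inE !negb_or !andbT.
  move=> /and4P[/and4P[n01 n02 n03 n04] /and3P[n12 n13 n14] /andP[n23 n24] n34].
  have := upE x0; have := upE x1; have := upE x2; have := upE x3; have := upE x4.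
  rewrite !big_cons !big_nil !eqxx ![x1 == x0]eq_sym ![x2 == x0]eq_sym ![x3 == x0]eq_sym.
  rewrite ![x4 == x0]eq_sym ![x2 == x1]eq_sym ![x3 == x1]eq_sym ![x4 == x1]eq_sym.
  rewrite ![x3 == x2]eq_sym ![x4 == x2]eq_sym ![x4 == x3]eq_sym.
  rewrite n01 n02 n03 n04 n12 n13 n14 n23 n24 n34 /=.
  rewrite ![p x1 x0]pC ![p x2 x0]pC ![p x3 x0]pC [p x0 x4]pC ![p x2 x1]pC ![p x3 x1]pC.
  rewrite ![p x4 x1]pC ![p x3 x2]pC ![p x4 x2]pC ![p x4 x3]pC.
  rewrite (pe _ _ e01) (pe _ _ e12) (pe _ _ e23) (pe _ _ e34) (pe _ _ e40) !(addr0, add0r).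
  move=> h4 h3 h2 h1 h0.
  (* The cycle of non-edges is odd: going around it once returns a value as its own negative. *)
  have two : (2%:R : k) != 0 by rewrite ((pcharf0P k).1 char0).
  have E14 : p x1 x4 = - p x2 x4 by apply/eqP; rewrite -addr_eq0 h4.
  have E13 : p x1 x3 = - p x0 x3 by apply/eqP; rewrite -addr_eq0 addrC h3.
  have E02 : p x0 x2 = - p x2 x4 by apply/eqP; rewrite -addr_eq0 h2.
  have E03 : p x0 x3 = p x2 x4 by apply/eqP; rewrite -subr_eq0 -E02 addrC h0.
  have E24 : p x2 x4 = 0.
    apply/eqP; move: h1; rewrite E13 E14 E03 => /eqP.
    by rewrite -opprD oppr_eq0 -mulr2n -mulr_natr mulf_eq0 (negPf two) orbF.
  by rewrite E02 E13 E14 E03 E24 oppr0.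
move=> T; have [Ts|nTs] := boolP (T \subset [set x in s]); last by apply: supp; rewrite nTs.
have [Td|nTd] := boolP (T \in slice e 2); last by apply: supp; rewrite nTd orbT.
have /andP[_ /cards2P[x [y [xy TE]]]] : stable e T && (#|T| == 2) by move: Td; rewrite inE.
have : x \in s /\ y \in s.
  by move/subsetP: Ts; rewrite TE => Ts; split; have := Ts _ (set21 x y); have := Ts _ (set22 x y); rewrite !inE.
rewrite TE -/(p x y) !inE; case: pE => p02 p03 p13 p14 p24.
have [p01 p12 p23 p34] := And4 (pe _ _ e01) (pe _ _ e12) (pe _ _ e23) (pe _ _ e34).
have p04 : p x0 x4 = 0 by rewrite pC pe.
by case=> /or4P[|||/orP[]] /eqP xE /or4P[|||/orP[]] /eqP yE; subst x y;
  rewrite ?eqxx // in xy *; rewrite // pC.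
Qed.

End FullRank.

(** * Kernel vectors and functionals vanishing on the image *)

Section Failure.
Variables (k : fieldType) (I : finType) (e : rel I).
Implicit Types (S T A B : {set I}) (v w phi : {set I} -> k) (x : I).

Definition null_vector A v := forall T, T \subset A -> stable e T -> down v T = 0.

Lemma null_vector_not_inj_on A d v S : null_vector A v ->
  S \subset A -> S \in slice e d -> v S != 0 -> ~ inj_on k e A d.
Proof.
move=> nv SA Sd /eqP vS inj; apply: vS; apply: inj SA Sd => T TA.
by rewrite inE => /andP[st _]; apply: nv.
Qed.

(** For kernel elements f and g in disjoint sets of variables, the sum of all variables sends fg to
    (l_A f) g + f (l_B g) = 0. Edges between [A] and [B] only make more monomials vanish. *)
Lemma null_vector_join A B v w : [disjoint A & B] ->
  null_vector A v -> null_vector B w ->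
  null_vector (A :|: B) (fun S => v (S :&: A) * w (S :&: B)).
Proof.
move=> dAB nv nw T TAB st.
rewrite /down (bigID (mem A)) /=.
rewrite (eq_bigr (fun i => v ((T :&: A) :\ i) * w (T :&: B))); last first.
  move=> i /andP[iT iA]; rewrite !setIDAC; congr (v _ * w _).
  apply/setDidPl; rewrite disjoint_sym disjoints1 inE negb_and.
  by rewrite (disjointFr dAB iA) orbT.
rewrite -mulr_suml [X in _ + X](eq_bigr (fun i => v (T :&: A) * w ((T :&: B) :\ i))); last first.
  move=> i /andP[iT iA]; rewrite !setIDAC; congr (v _ * w _).
  apply/setDidPl; rewrite disjoint_sym disjoints1 inE negb_and.
  by rewrite iA orbT.
rewrite -mulr_sumr.
have -> : \sum_(i in T | i \in A) v ((T :&: A) :\ i) = 0.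
  rewrite -[RHS](nv (T :&: A)) ?subsetIr ?(stableS (subsetIl _ _) st) //.
  by apply: eq_bigl => i; rewrite inE.
have -> : \sum_(i in T | i \notin A) w ((T :&: B) :\ i) = 0.
  rewrite -[RHS](nw (T :&: B)) ?subsetIr ?(stableS (subsetIl _ _) st) //.
  apply: eq_bigl => i; rewrite inE; apply: andb_id2l => iT.
  have := subsetP TAB i iT; rewrite inE.
  by case: (boolP (i \in A)) => [/(disjointFr dAB) ->|].
by rewrite mul0r mulr0 addr0.
Qed.

(** The product of the variable x with each variable of [B], itself included, is zero. *)
Lemma null_vector_star B x : {in B, forall y, y != x -> e x y} ->
  null_vector B (fun S => (S == [set x])%:R).
Proof.
move=> ex T TB /stableP st; apply: big1 => i iT; case: eqP => // ET.
have /setD1P[xi xT] : x \in T :\ i by rewrite ET set11.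
by have := st x i xT iT; rewrite ex // ?(subsetP TB) // eq_sym.
Qed.

(* If [alpha] and [beta] are the sums of the variables in [A] and [B], then
   alpha^(m+1) = beta^(m+1) = 0, so alpha + beta kills the alternating sum of
   the products alpha^a beta^b over a + b = m. *)
Definition alternating A B (m : nat) S : k :=
  if #|S| == m then (-1) ^+ #|S :&: A| * (#|S :&: A|`! * #|S :&: B|`!)%:R else 0.

Lemma null_vector_alternating A B m : [disjoint A & B] ->
  (forall T, T \subset A -> stable e T -> (#|T| <= m)%N) ->
  (forall T, T \subset B -> stable e T -> (#|T| <= m)%N) ->
  null_vector (A :|: B) (alternating A B m).
Proof.
move=> dAB mA mB T TAB st.
have [cT|cT] := eqVneq #|T| m.+1; last first.
  apply: big1 => i iT; rewrite /alternating; case: eqP => // ci; case/eqP: cT.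
  by rewrite (cardsD1 i) iT ci.
have := mA (T :&: A) (subsetIr _ _) (stableS (subsetIl _ _) st).
have := mB (T :&: B) (subsetIr _ _) (stableS (subsetIl _ _) st).
have cAB : (#|T :&: A| + #|T :&: B|)%N = m.+1.
  rewrite -cT -(cardsID A T); congr (_ + _)%N; apply: eq_card => i.
  rewrite !inE [RHS]andbC; apply: andb_id2l => iT.
  have := subsetP TAB i iT; rewrite inE.
  by case: (boolP (i \in A)) => [/(disjointFr dAB) ->|].
(* Neither part of [T] exceeds [m], so both are nonempty, of sizes a + 1 and b + 1. Removing a point
   of [A] or a point of [B] gives two sums of absolute value (a+1)! (b+1)! and opposite signs. *)
case Ea : #|T :&: A| cAB => [|a] cAB; first by lia.
case Eb : #|T :&: B| cAB => [|b] cAB; first by lia.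
move=> _ _.
rewrite /down (bigID (mem A)) /=.
rewrite (eq_bigr (fun=> (-1) ^+ a * (a`! * b.+1`!)%:R)); last first.
  move=> i /andP[iT iA]; rewrite /alternating !setIDAC.
  have -> : (T :&: B) :\ i = T :&: B.
    apply/setDidPl; rewrite disjoint_sym disjoints1 inE negb_and.
    by rewrite (disjointFr dAB iA) orbT.
  have -> : #|(T :&: A) :\ i| = a by move: Ea; rewrite (cardsD1 i) inE iT iA => -[].
  by rewrite Eb; move: cT; rewrite (cardsD1 i) iT add1n => -[->]; rewrite eqxx.
rewrite [X in _ + X](eq_bigr (fun=> (-1) ^+ a.+1 * (a.+1`! * b`!)%:R)); last first.
  move=> i /andP[iT iA]; rewrite /alternating !setIDAC.
  have iB : i \in B by move: (subsetP TAB i iT); rewrite inE (negPf iA).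
  have -> : (T :&: A) :\ i = T :&: A.
    apply/setDidPl; rewrite disjoint_sym disjoints1 inE negb_and.
    by rewrite iA orbT.
  have -> : #|(T :&: B) :\ i| = b by move: Eb; rewrite (cardsD1 i) inE iT iB => -[].
  by rewrite Ea; move: cT; rewrite (cardsD1 i) iT add1n => -[->]; rewrite eqxx.
have cA : #|[pred i | i \in T & i \in A]| = a.+1.
  by rewrite -Ea; apply: eq_card => i; rewrite !inE.
have cB : #|[pred i | i \in T & i \notin A]| = b.+1.
  rewrite -Eb; apply: eq_card => i; rewrite !inE; apply: andb_id2l => iT.
  have := subsetP TAB i iT; rewrite inE.
  by case: (boolP (i \in A)) => [/(disjointFr dAB) ->|].
rewrite !sumr_const cA cB exprS mulN1r mulNr mulNrn -!mulrnAr -!mulrnA.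
apply/eqP; rewrite subr_eq0; apply/eqP; congr (_ * _%:R).
by rewrite !factS; lia.
Qed.

(** The support lies in [A], but [S] ranges over all sets, so the functional vanishes on the image
    for the whole graph. *)
Definition conull_functional A d phi :=
  (forall T, ~~ (T \subset A) || (T \notin slice e d) -> phi T = 0) /\
  (forall S, up phi S = 0).

Lemma conull_functional_not_surj_on A d phi T :
  conull_functional A d phi -> phi T != 0 -> ~ surj_on k e setT d.
Proof.
move=> [supp h] /eqP phiT surj; apply/phiT/surj => // U.
by rewrite subsetT /= => nU; apply: supp; rewrite nU orbT.
Qed.

Lemma conull_functional0 : conull_functional set0 0 (fun T => (T == set0)%:R).
Proof.
split=> [T|S]; last first.
  by apply: big1 => i _; case: eqP => // /setP/(_ i); rewrite setU11 inE.
case: eqP => // ->; rewrite sub0set inE cards0 eqxx andbT /=.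
by case/negP; apply/stableP => i j; rewrite inE.
Qed.

Hypotheses (e_irr : irreflexive e) (e_sym : ssrbool.symmetric e).

(** The product of [phi] with the difference of the coordinates at [p] and [q]. *)
Definition edge_alternation (p q : I) phi T : k :=
  if p \in T then (if q \in T then 0 else phi (T :\ p))
  else (if q \in T then - phi (T :\ q) else 0).

(** If [S] misses both ends, the terms adding [p] and [q] cancel; if it contains exactly one, the
    sum is, up to sign, [up phi] at [S] without that end. Isolation from [A] keeps the sets of the
    support stable. *)
Lemma conull_functional_edge A d phi p q :
  conull_functional A d phi -> p \notin A -> q \notin A -> e p q ->
  {in A, forall i, ~~ e p i && ~~ e q i} ->
  conull_functional (p |: (q |: A)) d.+1 (edge_alternation p q phi).
Proof.
move=> [supp h] pA qA epq isoA.
have pq : p != q by apply: contraTneq epq => ->; rewrite e_irr.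
have phi0 T i : i \in T -> i \notin A -> phi T = 0.
  by move=> iT iA; apply: supp; apply/orP; left; apply/subsetPn; exists i.
have lift T i : i \in T -> i \in [set p; q] -> phi (T :\ i) != 0 ->
    (T \subset p |: (q |: A)) && (T \in slice e d.+1).
  move=> iT ipq nz.
  have /norP[] : ~~ (~~ (T :\ i \subset A) || (T :\ i \notin slice e d)).
    by apply: contra nz => /supp ->.
  rewrite !negbK inE => TA /andP[st /eqP cT].
  have iA : {in A, forall j, ~~ e i j}.
    by move=> j /isoA /andP[ep eq]; move: ipq; rewrite !inE => /orP[] /eqP ->.
  rewrite inE (cardsD1 i) iT cT eqxx andbT -{2}(setD1K iT) stableU1 // st /=.
  apply/andP; split; last by apply/forall_inP => j /(subsetP TA)/iA.
  apply/subsetP => j jT; rewrite !inE; have [ji|ji] := eqVneq j i.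
    by move: ipq; rewrite ji !inE => /orP[] ->; rewrite ?orbT.
  by rewrite (subsetP TA) ?orbT // !inE ji.
split=> [T out|S].
  rewrite /edge_alternation; case: ifPn => pT; case: ifPn => qT //.
    apply/eqP; apply: contraTT out => /(lift _ _ pT).
    by rewrite !inE eqxx => /(_ isT); rewrite negb_or !negbK.
  apply/eqP; rewrite oppr_eq0; apply: contraTT out => /(lift _ _ qT).
  by rewrite !inE eqxx orbT => /(_ isT); rewrite negb_or !negbK.
have swap i x : i != x -> (i |: S) :\ x = i |: (S :\ x).
  by move=> ix; apply/setP => y; rewrite !inE; case: (eqVneq y i) => [->|]; rewrite ?ix.
rewrite /up /edge_alternation; under eq_bigr do rewrite !in_setU1.
have [pS|pS] := boolP (p \in S); have [qS|qS] := boolP (q \in S).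
- by apply: big1 => i _; rewrite !orbT.
- rewrite -[RHS](h (S :\ p)) /up [RHS](bigD1 p) ?inE ?eqxx //=.
  rewrite (phi0 _ p) ?setU11 // add0r.
  rewrite (eq_bigl (fun i => (i \notin S :\ p) && (i != p))); last first.
    move=> i; rewrite !inE negb_and negbK.
    by case: (eqVneq i p) => [->|]; rewrite ?pS ?andbT ?andbF.
  apply: eq_bigr => i /andP[_ ip]; rewrite orbT orbF swap //.
  by case: eqP => // <-; rewrite (phi0 _ q) // setU11.
- rewrite -[RHS]oppr0 -[X in - X](h (S :\ q)) /up [X in - X](bigD1 q) ?inE ?eqxx //=.
  rewrite (phi0 _ q) ?setU11 // add0r -sumrN.
  rewrite (eq_bigl (fun i => (i \notin S :\ q) && (i != q))); last first.
    move=> i; rewrite !inE negb_and negbK.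
    by case: (eqVneq i q) => [->|]; rewrite ?qS ?andbT ?andbF.
  apply: eq_bigr => i /andP[_ iq]; rewrite orbT orbF swap //.
  by case: eqP => // <-; rewrite (phi0 _ p) ?setU11 ?oppr0.
- rewrite (bigD1 p) //= (bigD1 q) /=; last by rewrite qS eq_sym.
  rewrite !eqxx [q == p]eq_sym (negPf pq) !orbF /= !setU1K //.
  rewrite big1 ?addr0 ?subrr // => i /andP[/andP[_ ip] iq].
  by rewrite eq_sym (negPf ip) eq_sym (negPf iq).
Qed.

End Failure.

(** * Full rank certified by a computed deletion tree *)

Section Certificate.
Variable adj : nat -> nat -> bool.
Implicit Types (s : seq nat) (d x : nat).

Definition independent s := all (fun x => all (fun y => ~~ adj x y) s) s.
Definition degree s x := count (adj x) s.

(* Nested conditionals, since the call-by-value evaluation of [||] and [&&] by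
   [vm_compute] would explore the whole binary tree. *)
Fixpoint certify (leaf : seq nat -> nat -> bool) (pivot : seq nat -> nat)
    (fuel : nat) s d : bool :=
  if leaf s d then true else
  if fuel is fuel'.+1 then
    let x := pivot s in
    if certify leaf pivot fuel' [seq y <- s | y != x] d then
      if d is d'.+1 then
        certify leaf pivot fuel' [seq y <- s | (y != x) && ~~ adj x y] d'
      else true
    else false
  else false.

Definition inj_leaf s d := independent s && ((d.*2 < size s) || (size s < d))%N.
(** The second alternative is the 5-cycle, for multiplication from degree 1 to degree 2. *)
Definition surj_leaf s d :=
  (independent s && (size s < d.*2)%N) || ((s == iota 0 5) && (d == 2)).

(** Any pivot is sound; the choice only steers the search. Degrees in a tadpole are at most 3, so
    this is a vertex of largest degree. *)
Definition inj_pivot s :=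
  head 0%N (flatten [seq [seq x <- s | degree s x == m] | m <- [:: 3; 2; 1]%N]).
(** Initially this is the neighbour of the far end of the tail; deleting it isolates that end. *)
Definition surj_pivot s := nth 0%N (rev [seq x <- s | (0 < degree s x)%N]) 1.

Definition full_rank_check (N : nat) : bool :=
  all (fun d => if certify inj_leaf inj_pivot N (iota 0 N) d then true
                else certify surj_leaf surj_pivot N (iota 0 N) d.+1) (iota 0 N).

Variables (k : fieldType) (N : nat).
Hypotheses (adj_irr : irreflexive adj) (adj_sym : ssrbool.symmetric adj).
Hypothesis char0 : [pchar k] =i pred0.
Let e : rel 'I_N := ord_rel adj.

Definition vertices s : {set 'I_N} := [set i : 'I_N | val i \in s].

Lemma ord_rel_irr : irreflexive e.
Proof. by move=> i; apply: adj_irr. Qed.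

Lemma ord_rel_sym : ssrbool.symmetric e.
Proof. by move=> i j; apply: adj_sym. Qed.

Lemma card_vertices s : uniq s -> all (gtn N) s -> #|vertices s| = size s.
Proof.
move=> us /allP sN; rewrite cardE -(size_map val); apply/perm_size/uniq_perm => //.
  by rewrite map_inj_uniq ?enum_uniq //; apply: val_inj.
move=> x; apply/mapP/idP => [[i]|xs]; first by rewrite mem_enum inE => h ->.
by exists (Ordinal (sN x xs)); rewrite ?mem_enum ?inE.
Qed.

Lemma stable_vertices s : independent s -> stable e (vertices s).
Proof.
move=> /allP h; apply/stableP => i j; rewrite !inE => iS jS.
exact: (allP (h i iS)) j jS.
Qed.

Lemma certify_sound (P : {set 'I_N} -> nat -> Prop)
    (leaf : seq nat -> nat -> bool) (pivot : seq nat -> nat) fuel s d :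
  (forall s d, uniq s -> all (gtn N) s -> leaf s d -> P (vertices s) d) ->
  (forall (A : {set 'I_N}) d (x : 'I_N), P (A :\ x) d ->
     (forall d', d = d'.+1 -> P (A :\: nbhd e x) d') -> P A d) ->
  uniq s -> all (gtn N) s -> certify leaf pivot fuel s d -> P (vertices s) d.
Proof.
move=> leafP splitP; elim: fuel s d => [|fuel IH] s d us sN /=.
  by case: ifP => // lf _; apply: leafP.
case: ifP => [lf _|_]; first exact: leafP.
set x := pivot s; case: ifP => // cD cN.
have sub (p : pred nat) : uniq (filter p s) /\ all (gtn N) (filter p s).
  rewrite filter_uniq //; split=> //; apply/allP => y.
  by rewrite mem_filter => /andP[_]; apply: (allP sN).
have [uD aD] := sub (fun y => y != x).
(* A pivot outside the graph deletes nothing: the first recursive call concerns the same vertex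
   set. *)
have [xN|Nx] := ltnP x N; last first.
  have -> : vertices s = vertices [seq y <- s | y != x].
    apply/setP => i; rewrite !inE mem_filter andb_idl // => _.
    by apply: contraTneq (ltn_ord i) => ->; rewrite -leqNgt.
  exact: IH.
apply: (splitP _ _ (Ordinal xN)).
  have -> : vertices s :\ Ordinal xN = vertices [seq y <- s | y != x].
    by apply/setP => i; rewrite !inE mem_filter -val_eqE.
  exact: IH.
move=> d' dE; subst d.
have -> : vertices s :\: nbhd e (Ordinal xN) =
    vertices [seq y <- s | (y != x) && ~~ adj x y].
  by apply/setP => i; rewrite !inE mem_filter -val_eqE negb_or.
by have [uN aN] := sub (fun y => (y != x) && ~~ adj x y); apply: IH.
Qed.

Lemma inj_leaf_sound s d : uniq s -> all (gtn N) s -> inj_leaf s d ->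
  inj_on k e (vertices s) d.
Proof.
move=> us sN /andP[st /orP[]]; rewrite -(card_vertices us sN).
  by apply: inj_on_stable => //; exact: stable_vertices.
exact: inj_on_card.
Qed.

Hypothesis C5 : [&& adj 0 1, adj 1 2, adj 2 3, adj 3 4 & adj 4 0]%N.

Lemma surj_leaf_sound s d : uniq s -> all (gtn N) s -> surj_leaf s d ->
  surj_on k e (vertices s) d.
Proof.
move=> us sN /orP[/andP[st]|/andP[/eqP sE /eqP ->]].
  rewrite -(card_vertices us sN).
  by apply: surj_on_stable => //; exact: stable_vertices.
have N5 : (4 < N)%N by apply: (allP sN); rewrite sE.
pose o i (iN : (i < 5)%N) : 'I_N := Ordinal (leq_trans iN N5).
have -> : vertices s = [set i in [:: @o 0 isT; @o 1 isT; @o 2 isT; @o 3 isT; @o 4 isT]].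
  by apply/setP => i; rewrite inE sE [iota 0 5]/= !inE -!val_eqE.
by move: C5 => /and5P[*]; apply: surj_on_C5.
Qed.

Lemma full_rank_check_sound : full_rank_check N ->
  forall d, inj_on k e setT d \/ surj_on k e setT d.+1.
Proof.
move=> /allP ok d; have [dN|Nd] := ltnP d N; last first.
  by right; apply: surj_on_card; rewrite cardsT card_ord.
have -> : [set: 'I_N] = vertices (iota 0 N).
  by apply/setP => i; rewrite !inE mem_iota ltn_ord.
have aN : all (gtn N) (iota 0 N) by apply/allP => x; rewrite mem_iota.
have := ok d; rewrite mem_iota => /(_ dN); case: ifP => [c _|_ c]; [left|right].
  apply: certify_sound c; rewrite ?iota_uniq //; first exact: inj_leaf_sound.
  by move=> A d' x; apply: inj_on_split; [exact: ord_rel_irr | exact: ord_rel_sym].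
apply: certify_sound c; rewrite ?iota_uniq //; first exact: surj_leaf_sound.
by move=> A d' x; apply: surj_on_split; [exact: ord_rel_irr | exact: ord_rel_sym].
Qed.

End Certificate.

(** * The tadpoles with a 5-cycle *)

Lemma tadpole_adj_irr n : irreflexive (tadpole_adj 5 n).
Proof. by move=> i; rewrite /tadpole_adj /tadpole_edge; lia. Qed.

Lemma tadpole_adj_sym m n : ssrbool.symmetric (tadpole_adj m n).
Proof. by move=> i j; rewrite /tadpole_adj orbC. Qed.

(** Numbered from 0, the bridge joins 4 to 5, so the graph is one path through all vertices together
    with the chord from 4 to 0. *)
Lemma tadpole_edgeE n i j : (j < 5 + n)%N ->
  tadpole_edge 5 n i j = (j == i.+1) || (i == 4) && (j == 0)%N.
Proof. by move=> jN; rewrite /tadpole_edge; lia. Qed.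

Section TadpoleFailure.
Variables (k : fieldType) (n : nat).
Hypothesis char0 : [pchar k] =i pred0.
Let N := (5 + n)%N.
Let e : rel 'I_N := ord_rel (tadpole_adj 5 n).
Implicit Types (S T : {set 'I_N}).

Definition interval (a b : nat) : {set 'I_N} := [set i : 'I_N | (a <= i < b)%N].

Lemma ord_tadpoleE (i j : 'I_N) : e i j =
  [|| j == i.+1 :> nat, (i == 4 :> nat) && (j == 0 :> nat),
      i == j.+1 :> nat | (j == 4 :> nat) && (i == 0 :> nat)]%N.
Proof. by rewrite /e /ord_rel /tadpole_adj !tadpole_edgeE ?ltn_ord // -orbA. Qed.

Lemma stable_interval2 T a : stable e T -> T \subset interval a a.+2 -> (#|T| <= 1)%N.
Proof.
move=> /stableP st /subsetP TA; apply/card_le1_eqP => i j iT jT.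
apply/eqP; rewrite eq_sym -val_eqE /=.
have := TA i iT; have := TA j jT; have := st i j iT jT.
by rewrite ord_tadpoleE !inE; lia.
Qed.

Lemma stable_interval4 T a : stable e T -> T \subset interval a a.+4 -> (#|T| <= 2)%N.
Proof.
move=> st /subsetP TA.
rewrite -(cardsID (interval a a.+2)) (@leq_add _ _ 1 1) //.
  exact: stable_interval2 (stableS (subsetIl _ _) st) (subsetIr _ _).
apply: (@stable_interval2 _ a.+2) (stableS (subsetDl _ _) st) _.
by apply/subsetP => i; rewrite !inE => /andP[iA /TA]; rewrite inE; lia.
Qed.

Lemma stable_cycle T : stable e T -> T \subset interval 0 5 -> (#|T| <= 2)%N.
Proof.
move=> st /subsetP TA; have N4 : (4 < N)%N by [].
(* Vertex 4 excludes 0 and 3, leaving the edge from 1 to 2; without it [T] lies in the path from 0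
   to 3. *)
have [T4|T4] := boolP (Ordinal N4 \in T).
  rewrite (cardsD1 (Ordinal N4)) T4 ltnS.
  apply: (@stable_interval2 _ 1) (stableS (subsetDl _ _) st) _.
  apply/subsetP => i; rewrite !inE -val_eqE => /andP[i4 iT].
  have := TA i iT; have := stableP _ _ st _ _ T4 iT.
  by rewrite ord_tadpoleE inE /= in i4 *; lia.
apply: (@stable_interval4 _ 0) st _; apply/subsetP => i iT.
have : i != Ordinal N4 by apply: contraNneq T4 => <-.
by have := TA i iT; rewrite !inE -val_eqE /=; lia.
Qed.

(** The vector need not be homogeneous; [S] records a nonzero coefficient in degree [d]. *)
Definition has_null_vector (r d : nat) : Prop :=
  exists (v : {set 'I_N} -> k) (S : {set 'I_N}),
  [/\ null_vector e (interval 0 r) v, S \subset interval 0 r, S \in slice e d & v S != 0].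

Lemma null_vector_base : (8 < N)%N -> has_null_vector 9 2.
Proof.
move=> N8.
have lt i : (i < 9)%N -> (i < N)%N by move=> i9; apply: leq_trans N8.
(* Vertices 0 and 2 are not adjacent in the cycle, and the coefficient of their product, coming from
   c^2, is 2. *)
pose x0 := Ordinal (lt 0%N isT); pose x2 := Ordinal (lt 2 isT).
exists (alternating k (interval 0 5) (interval 5 9) 2), [set x0; x2].
have SC : [set x0; x2] \subset interval 0 5.
  by apply/subsetP => i; rewrite !inE -!val_eqE /=; lia.
have C2 : #|[set x0; x2]| = 2 by rewrite cards2.
split.
- have -> : interval 0 9 = interval 0 5 :|: interval 5 9.
    by apply/setP => i; rewrite !inE; lia.
  apply: null_vector_alternating => [|T TA st|T TA st].
  + by rewrite -setI_eq0; apply/eqP/setP => i; rewrite !inE; lia.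
  + exact: stable_cycle.
  + exact: (@stable_interval4 _ 5).
- by apply: subset_trans SC _; apply/subsetP => i; rewrite !inE; lia.
- rewrite inE C2 eqxx andbT; apply/stableP => i j.
  by rewrite ord_tadpoleE !inE -!val_eqE /=; lia.
rewrite /alternating C2 eqxx (setIidPl SC) C2 mulf_neq0 ?signr_eq0 //.
by rewrite ((pcharf0P k).1 char0) muln_eq0 negb_or -!lt0n !fact_gt0.
Qed.

(** The new support vertex is the second one of the block: [r.+1] has no neighbour below [r], so
    adding it to [S] keeps the set stable. *)
Lemma null_vector_extend r d s w (rN : (r.+1 < N)%N) : (4 < r)%N -> (1 < s)%N ->
  has_null_vector r d -> null_vector e (interval r (r + s)) w ->
  w [set Ordinal rN] != 0 :> k -> has_null_vector (r + s) d.+1.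
Proof.
move=> r4 s1 [v [S [nv SA Sd vS]]] nw wx; set x := Ordinal rN in wx.
have dis : [disjoint interval 0 r & interval r (r + s)].
  by rewrite -setI_eq0; apply/eqP/setP => i; rewrite !inE; lia.
have xB : x \in interval r (r + s) by rewrite inE /=; lia.
have xS : x \notin S.
  by apply/negP => /(subsetP SA); rewrite inE /=; lia.
exists (fun T => v (T :&: interval 0 r) * w (T :&: interval r (r + s))), (x |: S).
have AB : interval 0 (r + s) = interval 0 r :|: interval r (r + s).
  by apply/setP => i; rewrite !inE; lia.
split.
- by rewrite AB; apply: null_vector_join.
- by rewrite AB subUset sub1set inE xB orbT subsetU // SA.
- move: Sd; rewrite !inE => /andP[st /eqP cS]; rewrite cardsU1 xS cS eqxx andbT.
  rewrite stableU1 ?st /=; [|exact/ord_rel_irr/tadpole_adj_irr|exact/ord_rel_sym/tadpole_adj_sym].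
  apply/forall_inP => i /(subsetP SA).
  by rewrite inE ord_tadpoleE /=; lia.
have -> : (x |: S) :&: interval 0 r = S.
  by rewrite setIUl (setIidPl SA) (disjoint_setI0 _) ?set0U // disjoints1 inE /=; lia.
have -> : (x |: S) :&: interval r (r + s) = [set x].
  rewrite setIUl (setIidPl _) ?sub1set // (disjoint_setI0 _) ?setU0 //.
  by apply: disjointWl dis.
by rewrite mulf_neq0.
Qed.

Lemma null_vector_P3 r d : (4 < r)%N -> (r + 3 <= N)%N ->
  has_null_vector r d -> has_null_vector (r + 3) d.+1.
Proof.
move=> r4 rN nv; have xN : (r.+1 < N)%N by lia.
apply: (@null_vector_extend r d 3 (fun S => (S == [set Ordinal xN])%:R) xN) => //.
  apply: null_vector_star => i; rewrite inE -val_eqE ord_tadpoleE /=; lia.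
by rewrite eqxx oner_neq0.
Qed.

(** For [m = 1] the alternating form on the two end edges of the block is z_1 + z_2 - z_3 - z_4 up
    to sign. *)
Lemma null_vector_P4 r d : (4 < r)%N -> (r + 4 <= N)%N ->
  has_null_vector r d -> has_null_vector (r + 4) d.+1.
Proof.
move=> r4 rN nv; have xN : (r.+1 < N)%N by lia.
apply: (@null_vector_extend r d 4 (alternating k (interval r r.+2) (interval r.+2 r.+4) 1) xN) => //.
  have -> : interval r (r + 4) = interval r r.+2 :|: interval r.+2 r.+4.
    by apply/setP => i; rewrite !inE; lia.
  apply: null_vector_alternating => [|T TA st|T TA st].
  - by rewrite -setI_eq0; apply/eqP/setP => i; rewrite !inE; lia.
  - exact: stable_interval2 TA.
  - exact: stable_interval2 TA.
rewrite /alternating cards1 eqxx mulf_neq0 ?signr_eq0 //.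
by rewrite ((pcharf0P k).1 char0) muln_eq0 negb_or -!lt0n !fact_gt0.
Qed.

Lemma has_null_vectorP a b : (9 + 3 * a + 4 * b <= N)%N ->
  has_null_vector (9 + 3 * a + 4 * b) (2 + a + b).
Proof.
elim: b => [|b IH].
  elim: a => [|a IH] abN; first by apply: null_vector_base.
  have -> : (9 + 3 * a.+1 + 4 * 0 = (9 + 3 * a + 4 * 0) + 3)%N by lia.
  have -> : (2 + a.+1 + 0 = (2 + a + 0).+1)%N by lia.
  by apply: null_vector_P3; [lia|lia|apply: IH; lia].
move=> abN; have -> : (9 + 3 * a + 4 * b.+1 = (9 + 3 * a + 4 * b) + 4)%N by lia.
have -> : (2 + a + b.+1 = (2 + a + b).+1)%N by lia.
by apply: null_vector_P4; [lia|lia|apply: IH; lia].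
Qed.

(** The edges joining 3j + 1 to 3j + 2. The multiples of 3 separate them, and as 0 is one of these,
    the chord from 4 to 0 joins no two of them. *)
Definition matching (t : nat) : {set 'I_N} :=
  [set i : 'I_N | (i < 3 * t)%N && (i %% 3 != 0)%N].

Lemma has_conull_functional t : (3 * t <= N)%N ->
  exists phi : {set 'I_N} -> k, conull_functional e (matching t) t phi /\ exists T, phi T != 0.
Proof.
elim: t => [|t IH] tN.
  have -> : matching 0 = set0 by apply/setP => i; rewrite !inE.
  exists (fun T => (T == set0)%:R); split; first exact: conull_functional0.
  by exists set0; rewrite eqxx oner_neq0.
have [|phi [c [T phiT]]] := IH; first by lia.
have pN : ((3 * t).+1 < N)%N by lia.
have qN : ((3 * t).+2 < N)%N by lia.
set p := Ordinal pN; set q := Ordinal qN.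
have pM : p \notin matching t by rewrite inE /=; lia.
have qM : q \notin matching t by rewrite inE /=; lia.
exists (edge_alternation p q phi); split.
  have -> : matching t.+1 = p |: (q |: matching t).
    by apply/setP => i; rewrite !inE -!val_eqE /=; lia.
  apply: conull_functional_edge => //.
  - exact/ord_rel_irr/tadpole_adj_irr.
  - exact/ord_rel_sym/tadpole_adj_sym.
  - by rewrite ord_tadpoleE /= eqxx.
  - by move=> i; rewrite inE !ord_tadpoleE /=; lia.
have TM : T \subset matching t.
  by apply: contraNT phiT => nT; rewrite c.1 ?nT.
have pT : p \notin T by apply: contra pM => /(subsetP TM).
have qT : q \notin T by apply: contra qM => /(subsetP TM).
exists (p |: T); rewrite /edge_alternation setU11 !inE -val_eqE /= (negPf qT).
by rewrite gtn_eqF // setU1K.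
Qed.

Lemma tadpole_not_WLP a b : n = (4 + 3 * a + 4 * b)%N -> ~ has_WLP k N (tadpole_adj 5 n).
Proof.
move=> nE /(has_WLP_incidence _ (@tadpole_adj_irr n) char0)/(_ (2 + a + b)%N)[inj|surj].
  have [|v [S [nv SA Sd vS]]] := @has_null_vectorP a b; first by rewrite /N; lia.
  (* The blocks exhaust the vertices, since 5 + n = 9 + 3a + 4b. *)
  move: nv SA; have -> : interval 0 (9 + 3 * a + 4 * b) = setT.
    apply/setP => i; rewrite !inE; apply: leq_trans (ltn_ord i) _.
    by rewrite /N; lia.
  by move=> nv SA; apply: null_vector_not_inj_on nv SA Sd vS inj.
have [|phi [c [T phiT]]] := @has_conull_functional (2 + a + b).+1; first by rewrite /N; lia.
exact: conull_functional_not_surj_on c phiT surj.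
Qed.

End TadpoleFailure.

Theorem theorem4p4 (k : fieldType) (hk : [pchar k] =i pred0) (n : nat) (hn : (1 <= n)%N) :
  has_WLP k (5 + n) (tadpole_adj 5 n) <-> n \in [:: 1; 2; 3; 5; 6; 9]%N.
Proof.
split=> [WLP|nE].
  apply: contraPT WLP; rewrite !inE => nE.
  (* As 4b and b agree modulo 3, this is the least possible [b]. For n at least 4, the bound 4b <= n
     - 4 fails only for n = 5, 6 and 9. *)
  pose b := ((n - 4) %% 3)%N; pose a := ((n - 4 - 4 * b) %/ 3)%N.
  by apply: (@tadpole_not_WLP k n hk a b); rewrite /a /b; lia.
apply/(has_WLP_incidence _ (@tadpole_adj_irr n) hk).
apply: full_rank_check_sound => //.
- exact: tadpole_adj_irr.
- exact: tadpole_adj_sym.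
- by move: nE; rewrite !inE => /or4P[|||/or3P[]] /eqP ->; vm_compute.
Qed.
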